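(* Let $G$ be a finite soluble group and $d$ a positive integer such that all Sylow subgroups of $G$ can be generated by $d$ elements. Then $e(G)\le e(H_{\pi,d})$, where $\pi=\pi(G)\cup\{2\}$.
   Context: $e(G)$ is the expected number of uniformly random elements of $G$, drawn independently with replacement, needed until they generate $G$; equivalently $e(G)=\sum_{n\ge0}(1-P_G(n))$ with $P_G(n)$ the probability that $n$ random elements generate $G$. $\pi(G)$ is the set of primes dividing $|G|$. For a finite set of primes $\pi$ with $2\in\pi$ and a positive integer $d$, $H_{\pi,d}=\bigl(A\rtimes\langle y\rangle\bigr)\times C_2^{d-1}$, where $A=\prod_{p\in\pi\setminus\{2\}}C_p^d$ ($C_p$ cyclic of order $p$), $\langle y\rangle\cong C_2$, and $y$ acts on $A$ by inversion: $x^y=x^{-1}$ for all $x\in A$. *)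

(* Defs.v *)
From HB Require Import structures.
From mathcomp Require Import all_boot all_fingroup all_algebra all_solvable.
From Stdlib Require Import Reals.

Set Implicit Arguments.
Unset Strict Implicit.
Unset Printing Implicit Defensive.

Local Open Scope group_scope.

Definition gen_count (gT : finGroupType) (G : {group gT}) (n : nat) : nat :=
  #|[set f : {ffun 'I_n -> gT} | (f \in ffun_on G) && (<<[set f i | i : 'I_n]>> == G)]|.

Definition probgen (gT : finGroupType) (G : {group gT}) (n : nat) : R :=
  Rdiv (INR (gen_count G n)) (INR (expn #|G| n)).

Definition e_is (gT : finGroupType) (G : {group gT}) (x : R) : Prop :=
  infinite_sum (fun n => Rminus 1 (probgen G n)) x.

Section Hpid.
Variables (pi : seq nat) (d : nat).

Definition Iodd : finType := seq_sub [seq p <- pi | p != 2%N].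

(* C_p^d, written additively as 'Z_p *)
Definition Afam (i : Iodd) : finGroupType := {dffun 'I_d -> 'Z_(ssval i)}%type.

Definition AT : finGroupType := {dffun forall i : Iodd, Afam i}.

Lemma AT_mulC (a b : AT) : a * b = b * a.
Proof.
apply/ffunP => i; rewrite !ffunE; apply/ffunP => j; rewrite !ffunE.
exact: Zp_mulgC.
Qed.

(* action of y^s on A: identity if s = false, inversion if s = true *)
Definition twist (s : bool) (a : AT) : AT := if s then a^-1 else a.

Lemma twistM s (a b : AT) : twist s (a * b) = twist s a * twist s b.
Proof. by case: s => //=; rewrite invMg AT_mulC. Qed.

Lemma twistK s t (a : AT) : twist s (twist t a) = twist (addb s t) a.
Proof. by case: s; case: t => //=; rewrite invgK. Qed.

(* the semidirect product A x| <y>, <y> = C_2 modelled by (bool, xor) *)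
Definition dihT : Type := (AT * bool)%type.
HB.instance Definition _ := Finite.on dihT.

Definition dih_mul (x y : dihT) : dihT := (x.1 * twist x.2 y.1, addb x.2 y.2).
Definition dih_inv (x : dihT) : dihT := (twist x.2 x.1^-1, x.2).
Definition dih_one : dihT := (1, false).

Lemma dih_mulA : associative dih_mul.
Proof.
move=> [a s] [b t] [c u]; rewrite /dih_mul /=.
by rewrite twistM twistK mulgA addbA.
Qed.

Lemma dih_mul1 : left_id dih_one dih_mul.
Proof. by move=> [a s]; rewrite /dih_mul /= mul1g. Qed.

Lemma dih_mulV : left_inverse dih_one dih_inv dih_mul.
Proof.
move=> [a s]; rewrite /dih_mul /dih_inv /= addbb.
by case: s; rewrite /= ?invgK ?mulgV ?mulVg.
Qed.

HB.instance Definition _ := Finite_isGroup.Build dihT dih_mulA dih_mul1 dih_mulV.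

Definition HT : finGroupType := (dihT * {dffun 'I_d.-1 -> 'Z_2})%type.

Definition Hpid : {group HT} := [set: HT]%G.

End Hpid.

(* Main.v *)
(** The inequality holds term by term: for every [n], [n] random elements
    generate [G] with at least the probability that they generate [H].

    Let [N] be a minimal normal subgroup of the soluble group [G], a [p]-group
    say, with [c] complements in [G].  A lift to [G] of a generating [n]-tuple of
    [G / N] generates either [G] or a complement of [N], and each complement
    contains exactly one lift, so P_G(n) = P_{G/N}(n) (1 - c / |N|^n).  Let [P] be a
    Sylow [p]-subgroup of [G].  By Gaschutz's transitivity theorem a complement of
    [N] in [G] is determined, up to conjugation in [N], by its intersection with
    [P], which is a complement of [N] in [P]; such a complement is in turn
    determined by the lifts of generators of [P / N].  Hence
    c <= |N|^(t + m(P / N)), where m is the minimal number of generators and [t] is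
    0 if [N] is central and 1 otherwise.  If c > 0 then [N] is not contained in the
    Frattini subgroup of [P], so m(P / N) < m(P).  Induction on [G] bounds P_G(n)
    from below by the product, over 2 and the odd primes p dividing |G|, of
      prod_{i<d} (1 - 2^(i-n))   and   prod_{i<d} (1 - p^(i+1-n)).

    This product is P_H(n): if [n] elements generate [H], then over each prime
    field the coordinate vectors in F^n of their [C_p^d]-components (or
    [C_2^(d-1)]-components) are linearly independent of each other and of the
    nonzero vector of their [y]-exponents. *)
From Stdlib Require Import Reals Lra.
Require Import Defs.
From HB Require Import structures.
From mathcomp Require Import all_boot all_order all_fingroup all_algebra.
From mathcomp Require Import all_solvable.
From mathcomp Require Import zify ring.

Set Implicit Arguments.
Unset Strict Implicit.
Unset Printing Implicit Defensive.

Import GroupScope Order.TTheory GRing.Theory Num.Theory.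

(** * Generator rank of p-groups *)

Section GeneratorRank.
Variable gT : finGroupType.
Implicit Types (p : nat) (G N P K L : {group gT}).

Lemma sub_mul_gen N P (X : {set gT}) :
  N <| P -> X \subset 'N(N) -> <<X / N>> = P / N -> P \subset N * <<X>>.
Proof.
by move=> /andP[_ nNP] nNX genX; rewrite -quotientSK // quotient_gen // genX.
Qed.

Lemma repr_mem_quotient N P (b : coset_of N) :
  N <| P -> b \in P / N -> repr (val b) \in P.
Proof.
move=> nsNP Pb; rewrite -(quotientGK nsNP); apply: mem_morphpre.
  exact: repr_coset_norm.
by rewrite /= coset_reprK.
Qed.

(** Burnside's basis theorem. Representatives of generators of [P / 'Phi(P)] generate [P] modulo
    ['Phi(P)], hence generate [P], and the quotient is a vector space over F_p. *)
Lemma grank_pgroup p P : p.-group P -> 'm(P) = logn p #|P : 'Phi(P)|.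
Proof.
move=> pP; have nsPhi := Phi_normal P; have nPhi := normal_norm nsPhi.
have abP := Phi_quotient_abelem pP.
have defm : 'm(P / 'Phi(P)) = logn p #|P : 'Phi(P)|.
  by rewrite grank_abelian ?(abelem_abelian abP) // (rank_abelem abP) card_quotient.
rewrite -defm; apply/eqP; rewrite eqn_leq quotient_grank // andbT.
have [B genB <-] := grank_witness (P / 'Phi(P)).
pose X := [set repr (val b) | b : coset_of 'Phi(P) in B].
have nX : X \subset 'N('Phi(P)).
  by apply/subsetP=> _ /imsetP[b _ ->]; apply: repr_coset_norm.
have defX : X / 'Phi(P) = B.
  apply/setP=> b; apply/idP/idP=> [/morphimP[x nx /imsetP[c Bc ->] ->]|Bb].
    by rewrite /= coset_reprK.
  rewrite -(coset_reprK b); apply: mem_morphim; first exact: repr_coset_norm.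
  exact: imset_f.
have sXP : X \subset P.
  rewrite -(quotientSGK nX (Phi_sub P)) defX -genB.
  exact: subset_gen.
have genX : <<X>> = P.
  apply: Phi_nongen; apply/eqP; rewrite eqEsubset join_subG Phi_sub sXP /=.
  apply: subset_trans (sub_mul_gen nsPhi nX _) _; first by rewrite defX.
  by rewrite -joing_idr mul_subG ?joing_subl ?joing_subr.
apply: leq_trans (leq_imset_card (fun b : coset_of 'Phi(P) => repr (val b)) (mem B)).
by rewrite -[in 'm(P)]genX grank_min.
Qed.

End GeneratorRank.

(** * Counting complements of a normal subgroup *)

Section Complements.
Variable gT : finGroupType.
Implicit Types (p : nat) (G N P K L : {group gT}).

(** If [N] lay in ['Phi(P)], then [L] and ['Phi(P)] would generate [P], so [L = P] and [N = 1]. So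
    [N <*> 'Phi(P)], whose image is the Frattini subgroup of [P / N], has smaller index in [P] than
    ['Phi(P)]. *)
Lemma grank_quotient_complement p P N L :
    p.-group P -> N <| P -> N :!=: 1 -> L \in [complements to N in P] ->
  'm(P / N) < 'm(P).
Proof.
move=> pP nsNP ntN /complP[tiNL defP]; have [sNP nNP] := andP nsNP.
have sLP : L \subset P by rewrite -defP mulG_subr.
rewrite (grank_pgroup pP) (grank_pgroup (quotient_pgroup N pP)).
rewrite -(quotient_Phi pP nNP).
have -> : 'Phi(P) / N = (N <*> 'Phi(P)) / N.
  by rewrite quotientYidl // (subset_trans (Phi_sub P)).
have sJP : N <*> 'Phi(P) \subset P by rewrite join_subG sNP Phi_sub.
rewrite index_quotient_eq //; last first.
  by rewrite (subset_trans _ (joing_subl _ _)) ?subsetIr.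
rewrite -(Lagrange_index sJP (joing_subr N 'Phi(P))) lognM ?indexg_gt0 //.
rewrite -[X in X < _]addn0 ltn_add2l logn_gt0.
have pidx : p.-nat #|N <*> 'Phi(P) : 'Phi(P)|.
  exact: pnat_dvd (dvdn_indexg _ _) (pgroupS sJP pP).
have [s|nsub] := boolP (N \subset 'Phi(P)).
  case/negP: ntN; rewrite -subG1 -tiNL subsetI subxx /=.
  suff -> : L :=: P by [].
  rewrite -[LHS]genGid; apply: Phi_nongen; apply/eqP; rewrite eqEsubset.
  rewrite join_subG Phi_sub sLP -{1}defP mul_subG ?joing_subr //.
  exact: subset_trans s (joing_subl _ _).
have : #|N <*> 'Phi(P) : 'Phi(P)| != 1%N.
  by rewrite indexg_eq1 join_subG (negPf nsub).
by rewrite -{1}(part_pnat_id pidx) p_part_eq1 negbK.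
Qed.

(** Splitting representatives of generators of [P / N] along [P = N L] gives elements of [L] that
    generate [L]. Hence their [N]-components determine [L]. *)
Lemma card_complements_grank P N : N <| P ->
  #|[complements to N in P]| <= #|N| ^ 'm(P / N).
Proof.
move=> nsNP; have [sNP nNP] := andP nsNP.
have [B genB <-] := grank_witness (P / N).
have PB b : b \in B -> repr (val b) \in P.
  by move=> Bb; rewrite repr_mem_quotient // -genB mem_gen.
(* The value 1 off [B] places [F L] in [pffun_on 1 B N], which has [#|N| ^ #|B|] elements. *)
pose F L := [ffun b : coset_of N => if b \in B then divgr N L (repr (val b)) else 1].
rewrite -(card_pffun_on 1) -(card_in_imset (f := F)).
  apply: subset_leq_card; apply/subsetP=> _ /imsetP[L /complP[_ defP] ->].
  apply/pfamilyP; split=> [|x].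
    by apply/subsetP=> b; rewrite inE ffunE; case: ifP; rewrite ?eqxx.
  move=> Bx; rewrite ffunE Bx mem_divgr // defP PB //.
move=> L M cL cM eqF; apply/group_inj.
pose X := [set remgr N L (repr (val b)) | b in B].
have gen K : K \in [complements to N in P] -> F K = F L -> <<X>> = K.
  move=> /complP[tiK defP] eqK.
  have remE b : b \in B -> remgr N L (repr (val b)) = remgr N K (repr (val b)).
    move=> Bb; have := congr1 (fun f : {ffun _} => f b) eqK; rewrite !ffunE Bb => eqd.
    apply: (mulgI (divgr N L (repr (val b)))); rewrite -divgr_eq -eqd; exact: divgr_eq.
  have sXK : X \subset K.
    by apply/subsetP=> _ /imsetP[b Bb ->]; rewrite remE // mem_remgr // defP PB.
  have sKP : K \subset P by rewrite -defP mulG_subr.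
  have nX : X \subset 'N(N) by rewrite (subset_trans sXK) ?(subset_trans sKP).
  have cosE b : b \in B -> coset N (remgr N L (repr (val b))) = b.
    move=> Bb; rewrite -[RHS]coset_reprK [in RHS](divgr_eq N K (repr (val b))).
    rewrite remE // mkerl ?ker_coset ?mem_divgr ?defP ?PB //.
    by apply: (subsetP nNP); apply: (subsetP sKP); rewrite mem_remgr ?defP ?PB.
  have defX : X / N = B.
    apply/setP=> b; apply/idP/idP=> [/morphimP[x nx /imsetP[c Bc ->] ->]|Bb].
      by rewrite /= cosE.
    rewrite -(cosE b Bb); apply: mem_morphim; last exact: imset_f.
    by apply: (subsetP nX); apply: imset_f.
  have sP : P \subset N * <<X>> by apply: sub_mul_gen => //; rewrite defX.
  apply/eqP; rewrite eqEsubset gen_subG sXK /=; apply/subsetP=> x Kx.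
  have /mulsgP[n y Nn Xy xE] := subsetP sP x (subsetP sKP x Kx).
  have Ky : y \in K by move: y Xy {xE}; apply/subsetP; rewrite gen_subG.
  have : n \in N :&: K by rewrite inE Nn -(groupMr _ Ky) -xE.
  by rewrite tiK => /set1P n1; rewrite xE n1 mul1g.
by rewrite -(gen L cL erefl) (gen M cM (esym eqF)).
Qed.

Lemma complement_setI G N P K :
    N \subset P -> P \subset G -> K \in [complements to N in G] ->
  (K :&: P)%G \in [complements to N in P].
Proof.
move=> sNP sPG /complP[tiK defG]; apply/complP; split=> /=.
  by rewrite setIA tiK; apply/trivgP; rewrite subsetIl.
by rewrite group_modl // defG; apply/setIidPr.
Qed.

Lemma card_complements_Sylow p G N P :
    p.-Sylow(G) P -> N <| G -> p.-group N -> abelian N ->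
  #|[complements to N in G]| <=
    (#|N| ^ (~~ (G \subset 'C(N))) * #|N| ^ 'm(P / N))%N.
Proof.
move=> sylP nsNG pN cNN; have [sNG nNG] := andP nsNG.
have [sPG pP _] := and3P sylP.
have sNP : N \subset P by rewrite (normal_sub_max_pgroup (Hall_max sylP)).
have nsNP : N <| P := normalS sNP sPG nsNG.
have coNP : coprime #|N| #|G : P|.
  by rewrite (pnat_coprime pN) // -?(pHall_pgroup) //; case/and3P: sylP.
pose f K := (K :&: P)%G.
have fP K : K \in [complements to N in G] -> f K \in [complements to N in P].
  exact: complement_setI.
rewrite -sum1_card (partition_big f (mem [complements to N in P])) //=.
apply: (@leq_trans (\sum_(L in [complements to N in P])
                      #|N| ^ (~~ (G \subset 'C(N))))%N); last first.
  by rewrite sum_nat_const mulnC leq_mul2l card_complements_grank ?orbT.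
apply: leq_sum => L cL; rewrite sum1dep_card.
have [->|[K]] := set_0Vmem [set K | (K \in [complements to N in G]) && (f K == L)].
  by rewrite cards0.
rewrite inE => /andP[cK /eqP fK].
(* [S] suffices as a set of conjugators: if [G] centralises [N], conjugation by [N] fixes every
   complement. *)
pose S := if G \subset 'C(N) then [set 1] else (N : {set gT}).
have <- : #|S| = (#|N| ^ (~~ (G \subset 'C(N))))%N.
  by rewrite /S; case: ifP; rewrite ?cards1.
apply: leq_trans (leq_imset_card (fun x => (K :^ x)%G) (mem S)).
apply: subset_leq_card; apply/subsetP=> M; rewrite inE => /andP[cM /eqP fM].
have [|x Nx defM] := Gaschutz_transitive nsNG sNP sPG cNN coNP cK cM.
  by rewrite -[LHS]/(gval (f K)) fK -fM.
have [cGN|nc] := boolP (G \subset 'C(N)).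
  apply/imsetP; exists 1; rewrite /S ?cGN ?set11 //.
  apply/group_inj; rewrite defM /= conjsg1; apply/normP.
  have [_ defG] := complP cK; have sKG : K \subset G by rewrite -defG mulG_subr.
  by apply: (subsetP (cents_norm _)) Nx; rewrite centsC (subset_trans sKG).
by apply/imsetP; exists x; rewrite /S ?(negPf nc) //; apply/group_inj.
Qed.

End Complements.

(** * Generating tuples of a group and of its quotient by a minimal normal subgroup *)

Section GenCountQuotient.
Variables (gT : finGroupType) (G N : {group gT}) (n : nat).
Hypotheses (nsNG : N <| G) (cNN : abelian N) (minN : minnormal N G).

(** As [N] is abelian and normal in [G = N K], the intersection [N :&: K] is normal in [G]. By
    minimality it is trivial, since otherwise [K] contains [N] and equals [G]. *)
Lemma proper_supplement_complement (K : {group gT}) :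
  N * K = G -> K :!=: G -> K \in [complements to N in G].
Proof.
move=> defG neqKG; apply/complP; split=> //.
have [_ nNG] := andP nsNG; have /mingroupP[_ minN'] := minN.
have sKG : K \subset G by rewrite -defG mulG_subr.
apply/eqP; apply/negPn/negP=> ntI.
have nIG : G \subset 'N(N :&: K).
  rewrite -defG mul_subG //.
    by rewrite cents_norm // (subset_trans cNN) // centS ?subsetIl.
  by rewrite normsI ?normG // (subset_trans sKG).
have /setIidPl sNK : N :&: K = N by apply: minN'; rewrite ?subsetIl // ntI.
by case/eqP: neqKG; apply/eqP; rewrite eqEsubset sKG -defG mulSGid /=.
Qed.

Lemma gen_count_quotient_lower :
  gen_count (G / N)%G n * #|N| ^ n <=
    gen_count G n + #|[complements to N in G]| * gen_count (G / N)%G n.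
Proof.
have [sNG nNG] := andP nsNG.
(* [S] consists of all lifts of generating tuples of [G / N]. *)
pose S := [set f : {ffun 'I_n -> gT} |
            (f \in ffun_on G) && (N * <<[set f i | i : 'I_n]>> == G)].
pose cos (f : {ffun 'I_n -> gT}) := [ffun i => coset N (f i)].
have imcos (f : {ffun 'I_n -> gT}) : f \in ffun_on G ->
    [set cos f i | i : 'I_n] = [set f i | i : 'I_n] / N.
  move=> /ffun_onP Gf; apply/setP=> b; apply/imsetP/morphimP.
    move=> [i _ ->]; exists (f i); rewrite ?ffunE ?imset_f //.
    exact: subsetP (Gf i).
  by case=> x _ /imsetP[i _ ->] ->; exists i; rewrite ?ffunE.
have sG (f : {ffun 'I_n -> gT}) : f \in ffun_on G -> [set f i | i : 'I_n] \subset G.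
  by move=> /ffun_onP Gf; apply/subsetP=> _ /imsetP[i _ ->].
have leS : gen_count (G / N)%G n * #|N| ^ n <= #|S|.
  rewrite -[n in (_ ^ n)%N]card_ord -card_ffun_on -[#|ffun_on _|]cardsE -cardsX.
  pose F (u : {ffun 'I_n -> coset_of N} * {ffun 'I_n -> gT}) :=
    [ffun i => u.2 i * repr (val (u.1 i))].
  have cosF u : u.2 \in ffun_on N -> cos (F u) = u.1.
    move=> /ffun_onP Nu; apply/ffunP=> i; rewrite !ffunE.
    rewrite mkerl ?ker_coset ?Nu //; last exact: repr_coset_norm.
    exact: coset_reprK.
  rewrite -(card_in_imset (f := F)).
    apply: subset_leq_card; apply/subsetP=> f /imsetP[u Hu ->]; move: Hu.
    rewrite !in_set => /andP[/andP[/ffun_onP Gu1 /eqP genu1] Nu2].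
    have GF : F u \in ffun_on G.
      apply/ffun_onP=> i; rewrite ffunE groupM ?repr_mem_quotient ?Gu1 //.
      by rewrite (subsetP sNG) // (ffun_onP Nu2).
    rewrite GF eqEsubset mul_subG ?gen_subG ?sG //=.
    apply: sub_mul_gen => //; first exact: subset_trans (sG _ GF) nNG.
    by rewrite -imcos // cosF.
  move=> u v; rewrite !in_set => /andP[_ Nu] /andP[_ Nv] eqF.
  have eq1 : u.1 = v.1 by rewrite -cosF // eqF cosF.
  rewrite [u]surjective_pairing [v]surjective_pairing eq1; congr (_, _); apply/ffunP=> i.
  have := congr1 (fun f : {ffun _} => f i) eqF; rewrite !ffunE /= eq1.
  exact: mulIg.
apply: leq_trans leS _; rewrite -[X in _ + X]cardsX.
pose Good := [set f in S | <<[set f i | i : 'I_n]>> == G].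
rewrite -(cardsID Good S) leq_add //.
  apply: subset_leq_card; apply/subsetP=> f; rewrite in_setI !in_set.
  by case/andP=> /andP[-> _] /andP[_ ->].
(* A complement of [N] meets each coset of [N] once, so the complement generated by [f] and the
   cosets of its entries recover [f]. *)
pose h (f : {ffun 'I_n -> gT}) := (<<[set f i | i : 'I_n]>>%G, cos f).
have badP f : f \in S :\: Good ->
    [/\ f \in ffun_on G, <<[set f i | i : 'I_n]>>%G \in [complements to N in G]
      & N * <<[set f i | i : 'I_n]>> = G].
  rewrite in_setD [f \in Good]in_set [f \in S]in_set.
  move=> /and3P[/negP bad Gf /eqP defG]; split=> //.
  apply: (@proper_supplement_complement <<_>>%G) => //.
  apply/negP=> gen; apply: bad.
  by rewrite Gf defG eqxx.
rewrite -(card_in_imset (f := h)).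
  apply: subset_leq_card; apply/subsetP=> _ /imsetP[f /badP[Gf cf defG] ->].
  rewrite in_set /= cf in_set andTb; apply/andP; split.
    by apply/ffun_onP=> i; rewrite ffunE mem_quotient //; apply: (ffun_onP Gf).
  rewrite imcos // -quotient_gen; last exact: subset_trans (sG _ Gf) nNG.
  by rewrite -[in X in _ == X]defG quotientMidl.
move=> f g /badP[Gf cf _] /badP[Gg cg _] [eqfg eqc].
apply/ffunP=> i; pose K := <<[set f i | i : 'I_n]>>%G.
have Kf : f i \in K by rewrite mem_gen ?imset_f.
have Kg : g i \in K by rewrite /K /= eqfg mem_gen ?imset_f.
have /complP[tiK _] := cf.
have nK (x : gT) : x \in G -> x \in 'N(N) := subsetP nNG x.
have := congr1 (fun f : {ffun _} => f i) eqc; rewrite !ffunE => /rcoset_kercosetP.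
rewrite !nK ?(ffun_onP Gf) ?(ffun_onP Gg) // => /(_ isT isT).
rewrite mem_rcoset => Nfg; apply/eqP; rewrite eq_mulgV1 -in_set1 -set1gE -tiK.
by rewrite inE Nfg groupM ?groupV.
Qed.

End GenCountQuotient.

(** * Lower bound for P_G(n), with probabilities in [rat] *)

Definition gen_prob (gT : finGroupType) (G : {group gT}) n : rat :=
  ((gen_count G n)%:R / (#|G| ^ n)%:R)%R.

(* For r = d, the p-part of P_H(n): p ^ ((p != 2) + i) is the number of
   complements of the (i+1)-st chief factor C_p of H, which is central for p = 2
   and inverted by y for odd p. *)
Definition prime_factor n p r : rat :=
  (\prod_(i < r) (1 - (p ^ ((p != 2) + i))%:R / (p ^ n)%:R))%R.

Section Factor.
Local Open Scope ring_scope.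

Lemma subr_pexp_ratio_ge0 p m n : prime p -> (m <= n)%N ->
  0 <= 1 - (p ^ m)%:R / (p ^ n)%:R :> rat.
Proof.
move=> pr_p le_mn; rewrite subr_ge0 ler_pdivrMr ?ltr0n ?expn_gt0 ?prime_gt0 //.
by rewrite mul1r ler_nat leq_exp2l ?prime_gt1.
Qed.

(** The exponents of [p] in the numerators are at most [r <= n], so no factor is negative. *)
Lemma prime_factor_itv n p r : prime p -> (r <= n)%N -> 0 <= prime_factor n p r <= 1.
Proof.
move=> pr_p le_rn; apply/andP; split.
  apply: prodr_ge0 => i _; apply: subr_pexp_ratio_ge0 => //.
  by have := ltn_ord i; case: (p != 2)%N => /=; lia.
apply: prodr_ile1 => i; rewrite subr_pexp_ratio_ge0 //=.
  by rewrite lerBlDr lerDl divr_ge0 ?ler0n.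
by have := ltn_ord i; case: (p != 2)%N => /=; lia.
Qed.

Lemma prime_factors_itv n (s : seq nat) r :
    all prime s -> (forall p, p \in s -> (r p <= n)%N) ->
  0 <= \prod_(p <- s) prime_factor n p (r p) <= 1.
Proof.
move=> /allP prs le_rn; rewrite big_seq; apply/andP; split.
  by apply: prodr_ge0 => p sp; case/andP: (prime_factor_itv (prs p sp) (le_rn p sp)).
by apply: prodr_ile1 => p sp; rewrite prime_factor_itv ?prs ?le_rn.
Qed.

Lemma gen_prob_quotient (gT : finGroupType) (G N : {group gT}) n :
    N <| G -> abelian N -> minnormal N G ->
  gen_prob (G / N)%G n * (1 - #|[complements to N in G]|%:R / (#|N| ^ n)%:R)
    <= gen_prob G n.
Proof.
move=> nsNG cNN minN; have := gen_count_quotient_lower n nsNG cNN minN.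
rewrite /gen_prob; set c := #|[complements to N in G]|.
set a := gen_count (G / N)%G n; set b := gen_count G n.
have -> : (#|G| ^ n = #|N| ^ n * #|(G / N)%g| ^ n)%N.
  by rewrite -expnMn card_quotient ?normal_norm // Lagrange ?normal_sub.
have : (0 < #|N| ^ n)%N by rewrite expn_gt0 cardG_gt0.
have : (0 < #|(G / N)%g| ^ n)%N by rewrite expn_gt0 cardG_gt0.
move: (#|N| ^ n)%N (#|(G / N)%g| ^ n)%N => x y y_gt0 x_gt0.
rewrite -(ler_nat rat) natrD !natrM => le_ab.
have x0 : 0 < x%:R :> rat by rewrite ltr0n.
have y0 : 0 < y%:R :> rat by rewrite ltr0n.
rewrite ler_pdivlMr ?mulr_gt0 //.
have -> : a%:R / y%:R * (1 - c%:R / x%:R) * (x%:R * y%:R) = a%:R * x%:R - c%:R * a%:R :> rat.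
  by field; rewrite ?lt0r_neq0.
by rewrite lerBlDr.
Qed.

End Factor.

Lemma normal_card2_central (gT : finGroupType) (G N : {group gT}) :
  N <| G -> #|N| = 2%N -> G \subset 'C(N).
Proof.
move=> /andP[sNG nNG] N2; rewrite centsC; apply/subsetP=> x Nx; apply/centP=> g Gg.
have [->|ntx] := eqVneq x 1; first by rewrite /commute mulg1 mul1g.
have ntxg : x ^ g != 1 by rewrite conjg_eq1.
have Nxg : x ^ g \in N by rewrite memJ_norm // (subsetP nNG).
apply/commgP/conjg_fixP.
have : #|N :\ 1| = 1%N by move: N2; rewrite (cardsD1 1 N) group1 => -[].
move/eqP/cards1P=> [y defN].
have : x \in N :\ 1 by rewrite !inE ntx.
have : x ^ g \in N :\ 1 by rewrite !inE ntxg.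
by rewrite defN !inE => /eqP-> /eqP->.
Qed.

(** Exponents of [p] in [card_complements_bound], where [|N| = p^k]. The claim reads
    [k * t - u <= (k - 1) * (n - e)] over the integers: the left side is at most [k - 1] if
    [t <= u], and at most [k <= 2 * (k - 1)] if [1 < k]. *)
Lemma complement_exponent (t u : bool) k e n :
    0 < k -> e < n -> t <= u \/ 1 < k /\ e.+1 < n ->
  k * t + k * e + n <= u + e + k * n.
Proof.
case: k => // k _ lt_en [le_tu | [k_gt1 lt_e1n]].
  have le_n : (k * (t + e) <= k * n)%N.
    by rewrite leq_mul2l; case: (t) => /=; lia.
  by case: (t) (u) le_tu le_n => [] [] //= _; lia.
have le_n : (k * e.+2 <= k * n)%N by rewrite leq_mul2l lt_e1n orbT.
by case: (t) (u) => [] [] /=; lia.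
Qed.

(** Dividing by [p ^ n * #|N| ^ n] compares the factor of [N] with that of a chief factor C_p of H.
    A noncentral [N] costs an extra [#|N|], absorbed by [p != 2] for odd [p]. For [p = 2] it forces
    [#|N| >= 4], and then [e.+1 < n] makes up for it; in a 2-group [N] is central. *)
Lemma card_complements_bound n p (gT : finGroupType) (G N P : {group gT}) e :
    prime p -> p.-Sylow(G) P -> minnormal N G -> N \subset G -> p.-group N -> abelian N ->
    'm(P / N) <= e -> e < n -> 2.-group G \/ (p = 2%N -> e.+1 < n) ->
  #|[complements to N in G]| * p ^ n <= p ^ ((p != 2%N) + e) * #|N| ^ n.
Proof.
move=> pr_p sylP minN sNG pN cNN le_me lt_en H2.
have /mingroupP[/andP[ntN nNG] minN'] := minN.
have nsNG : N <| G by rewrite /normal sNG.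
have [k [k_gt0 cardN]] : exists k, 0 < k /\ #|N| = (p ^ k)%N.
  have [k defk] := p_natP pN; exists k; split=> //; rewrite lt0n; apply/eqP=> k0.
  by case/eqP: ntN; apply/card1_trivg; rewrite defk k0.
have := card_complements_Sylow sylP nsNG pN cNN.
set t : bool := ~~ _ => le_c.
have p_gt1 := prime_gt1 pr_p.
apply: (@leq_trans (#|N| ^ t * #|N| ^ e * p ^ n)%N).
  rewrite leq_mul2r (leq_trans le_c) ?orbT // leq_mul2l leq_pexp2l ?orbT //.
rewrite cardN -!expnM -!expnD leq_exp2l //.
apply: complement_exponent => //; have [p2|] := eqVneq p 2%N; last first.
  by left; apply: leq_b1.
have [tT|tF] := boolP t; [right | by left].
have k_gt1 : 1 < k.
  rewrite ltn_neqAle k_gt0 andbT eq_sym; apply/eqP=> k1; case/negP: tT.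
  by apply: normal_card2_central; rewrite // cardN k1 p2.
have {H2} lt_e1n : e.+1 < n.
  case: H2 => [G2|->//]; case/negP: tT; rewrite centsC.
  apply: subset_trans (subsetIr G _).
  apply/setIidPl; apply: minN'; rewrite ?subsetIl //.
  rewrite normsI ?normG //; last by rewrite normal_norm ?center_normal.
  by rewrite andbT meet_center_nil ?(pgroup_nil G2).
by [].
Qed.

(** [r] is a function so that the induction can lower it at a single prime; [s] stays fixed although
    [G / N] may have fewer primes. *)
Lemma prod_prime_factor_le_gen_prob n (s : seq nat) (gT : finGroupType)
    (G : {group gT}) (r : nat -> nat) :
    uniq s -> all prime s -> solvable G -> {subset primes #|G| <= s} ->
    (forall p, p \in s -> exists2 P : {group gT}, p.-Sylow(G) P & 'm(P) <= r p) ->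
    (forall p, p \in s -> r p <= n) -> 2.-group G \/ r 2%N < n ->
  (\prod_(p <- s) prime_factor n p (r p) <= gen_prob G n)%R.
Proof.
move=> uniq_s pr_s.
have [m] := ubnP #|G|; elim: m => // m IH in gT G r *.
rewrite ltnS => leGm solG sGs rkG le_rn H2.
have [G1|ntG] := eqVneq (G : {set gT}) 1.
  apply: (@le_trans _ _ 1%R); first by case/andP: (prime_factors_itv pr_s le_rn).
  rewrite /gen_prob G1 cards1 exp1n divr1 ler1n card_gt0; apply/set0Pn.
  exists [ffun=> 1]; rewrite in_set; apply/andP; split.
    by apply/ffun_onP=> i; rewrite ffunE group1.
  rewrite G1 eqEsubset sub1G andbT gen_subG; apply/subsetP=> _ /imsetP[i _ ->].
  by rewrite ffunE set11.
have [N minN sNG] := minnormal_exists ntG (normG G).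
have [nNG ntN abN] := minnormal_solvable minN sNG solG.
have nsNG : N <| G by rewrite /normal sNG.
have [p pr_p abelN] := is_abelemP abN.
have cNN := abelem_abelian abelN; have pN := abelem_pgroup abelN.
apply: le_trans (gen_prob_quotient n nsNG cNN minN).
have ltQm : #|(G / N)%G| < m by rewrite (leq_trans _ leGm) // ltn_quotient.
have solQ : solvable (G / N)%G by rewrite quotient_sol.
have sQs : {subset primes #|(G / N)%G| <= s}.
  move=> q; rewrite mem_primes => /and3P[pr_q _ q_dv]; apply: sGs.
  by rewrite mem_primes pr_q cardG_gt0 (dvdn_trans q_dv) // dvdn_quotient.
have sp : p \in s.
  apply: sGs; rewrite mem_primes pr_p cardG_gt0 (dvdn_trans _ (cardSg sNG)) //.
  have [_ ? _] := pgroup_pdiv pN ntN; by [].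
have sylQ q (P : {group gT}) : q.-Sylow(G) P -> q.-Sylow(G / N) (P / N).
  by move=> sylP; apply: quotient_pHall (subset_trans (pHall_sub sylP) nNG) sylP.
have Q2 : 2.-group G -> 2.-group (G / N)%G by move=> G2; apply: quotient_pgroup.
(* Without complements every lift of a generating tuple of [G / N] generates [G], and [r] is
   kept. *)
have [c0|] := set_0Vmem [complements to N in G].
  rewrite c0 cards0 mul0r subr0 mulr1; apply: IH => // [q sq|]; last by case: H2; auto.
  have [P sylP le_m] := rkG q sq; exists (P / N)%G; first exact: sylQ.
  by apply: leq_trans le_m; apply: quotient_grank; apply: subset_trans (pHall_sub sylP) nNG.
case=> K cK; have [P sylP le_m] := rkG p sp.
have [sPG pP _] := and3P sylP.
have sNP : N \subset P by rewrite (normal_sub_max_pgroup (Hall_max sylP)).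
have nsNP := normalS sNP sPG nsNG.
have lt_m := grank_quotient_complement pP nsNP ntN (complement_setI sNP sPG cK).
(* A complemented [N] lowers the rank of the Sylow [p]-subgroup, so [r] may drop by one at [p]. *)
pose e := (r p).-1; have lt_mr := leq_trans lt_m le_m.
have re : r p = e.+1 by rewrite prednK // (leq_ltn_trans _ lt_mr).
have le_me : 'm(P / N) <= e by rewrite -ltnS -re.
pose r' q := if q == p then e else r q.
have r'p : r' p = e by rewrite /r' eqxx.
have r'q q : q != p -> r' q = r q by rewrite /r' => /negPf->.
have le_r' q : r' q <= r q by rewrite /r'; case: eqP => // ->; rewrite re.
have le_r'n q : q \in s -> r' q <= n by move=> sq; apply: leq_trans (le_rn q sq).
have : (\prod_(q <- s) prime_factor n q (r' q) <= gen_prob (G / N)%G n)%R.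
  apply: IH => // [q sq|]; last first.
    by case: H2 => [|lt_rn]; [left; auto | right; apply: leq_ltn_trans lt_rn].
  have [-> | neq_qp] := eqVneq q p.
    by exists (P / N)%G; [exact: sylQ | rewrite r'p].
  have [R sylR le_mR] := rkG q sq; exists (R / N)%G; first exact: sylQ.
  rewrite r'q //; apply: leq_trans le_mR.
  by apply: quotient_grank; apply: subset_trans (pHall_sub sylR) nNG.
move=> le_IH.
(* Passing from [e] to [e.+1] at [p] contributes exactly the last factor of [prime_factor]. *)
have -> : (\prod_(q <- s) prime_factor n q (r q) =
    \prod_(q <- s) prime_factor n q (r' q) * (1 - (p ^ ((p != 2) + e))%:R / (p ^ n)%:R))%R.
  rewrite !(bigD1_seq p) //= re r'p /prime_factor big_ord_recr /=.
  by rewrite (eq_bigr (fun q => prime_factor n q (r' q))) 1?mulrAC // => q /r'q->.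
have lt_en : e < n by rewrite -re le_rn.
have p_gt0 := prime_gt0 pr_p.
apply: ler_pM => //; first by case/andP: (prime_factors_itv pr_s le_r'n).
  apply: subr_pexp_ratio_ge0 => //; apply: leq_trans lt_en.
  by rewrite -[e.+1]add1n leq_add2r leq_b1.
rewrite lerD2l lerN2 ler_pdivrMr ?ltr0n ?expn_gt0 ?cardG_gt0 // mulrAC.
rewrite ler_pdivlMr ?ltr0n ?expn_gt0 ?p_gt0 // -!natrM ler_nat.
apply: (@card_complements_bound n p _ G N P e) => //.
by case: H2; [left | right=> p2; rewrite -re p2].
Qed.

(** * Counting matrices of full row rank *)

Lemma card_dep_pair (A B : finType) (P : pred A) (Q : A -> pred B) :
  #|[set x : A * B | P x.1 && Q x.1 x.2]| = (\sum_(a | P a) #|Q a|)%N.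
Proof.
rewrite -sum1_card (eq_bigl (fun x => P x.1 && Q x.1 x.2)); last by move=> x; rewrite inE.
rewrite -(pair_big_dep P Q (fun _ _ => 1%N)) /=.
by apply: eq_bigr => a _; rewrite sum1_card.
Qed.

Section RowFree.
Variables (F : finFieldType) (n : nat).
Local Open Scope ring_scope.

Lemma card_not_submx m (V : 'M[F]_(m, n)) : row_free V ->
  (#|[set b : 'rV[F]_n | ~~ (b <= V)%MS]| <= #|F| ^ n - #|F| ^ m)%N.
Proof.
move=> Vfree; have -> : [set b : 'rV[F]_n | ~~ (b <= V)%MS] = ~: [set b | (b <= V)%MS].
  by apply/setP=> b; rewrite !inE.
rewrite cardsCs setCK card_mx mul1n leq_sub2l //.
rewrite -[m in (_ ^ m)%N]mul1n -card_mx -(card_imset _ (row_free_inj Vfree)).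
by apply: subset_leq_card; apply/subsetP=> _ /imsetP[u _ ->]; rewrite inE submxMl.
Qed.

(** The rows of [B] are chosen one at a time, each outside the span of the [m + i] rows before
    it. *)
Lemma card_row_free_ext k m (V : 'M[F]_(m, n)) : row_free V ->
  (#|[set B : 'M[F]_(k, n) | row_free (col_mx V B)]| <=
     \prod_(i < k) (#|F| ^ n - #|F| ^ (m + i)))%N.
Proof.
elim: k m V => [|k IH] m V Vfree.
  rewrite big_ord0 (leq_trans (max_card _)) // card_mx mul0n expn0 //.
pose split (B : 'M[F]_(1 + k, n)) := (usubmx B, dsubmx B).
have split_inj : injective split.
  by move=> B C [eu ed]; rewrite -[B]vsubmxK eu ed vsubmxK.
pose P (b : 'rV[F]_n) := ~~ (b <= V)%MS.
pose Q (b : 'rV[F]_n) (B : 'M[F]_(k, n)) := row_free (col_mx (col_mx V b) B).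
rewrite -(card_imset _ split_inj).
apply: (@leq_trans #|[set x : 'rV[F]_n * 'M[F]_(k, n) | P x.1 && Q x.1 x.2]|).
  apply: subset_leq_card; apply/subsetP=> x /imsetP[B Bfree ->]; rewrite inE /=.
  rewrite inE -{1}[B]vsubmxK in Bfree.
  set b := usubmx B; set C := dsubmx B; rewrite -/b -/C in Bfree.
  have e1 : (col_mx (col_mx V b) C :=: V + b + C)%MS.
    exact: eqmx_trans (eqmx_sym (addsmxE _ _))
                      (adds_eqmx (eqmx_sym (addsmxE _ _)) (eqmx_refl _)).
  have e2 : (col_mx V (col_mx b C) :=: V + (b + C))%MS.
    exact: eqmx_trans (eqmx_sym (addsmxE _ _))
                      (adds_eqmx (eqmx_refl _) (eqmx_sym (addsmxE _ _))).
  have rkE : \rank (V + b + C)%MS = (m + 1 + k)%N.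
    by rewrite -addsmxA -e2 -addnA; apply/eqP.
  rewrite /Q /row_free e1 rkE eqxx andbT; apply/negP=> /addsmx_idPl sbV.
  have := rank_leq_row (col_mx V C); rewrite -addsmxE -(adds_eqmx sbV (eqmx_refl C)) rkE.
  by rewrite leq_add2r addn1 ltnn.
rewrite card_dep_pair big_ord_recl addn0.
apply: (@leq_trans (\sum_(b | P b) \prod_(i < k) (#|F| ^ n - #|F| ^ (m + 1 + i)))%N).
  apply: leq_sum => b Pb; rewrite -[#|_|]cardsE IH //.
  rewrite -row_leq_rank -addsmxE addn1 -[m in (m < _)%N](eqP Vfree).
  rewrite ltn_neqAle (mxrank_leqif_sup (addsmxSl V b)) addsmx_sub submx_refl /=.
  by rewrite -/(P b) Pb mxrankS ?addsmxSl.
rewrite sum_nat_const; apply: leq_mul.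
  by rewrite -[#|_|]cardsE card_not_submx.
by under eq_bigr => i _ do rewrite addn1 addSnnS.
Qed.

End RowFree.

(** * Linear independence of the coordinates of a generating tuple *)

Section GenRowFree.
Variables (hT : finGroupType) (n : nat) (f : {ffun 'I_n -> hT}).
Hypothesis genf : <<[set f i | i : 'I_n]>> = [set: hT].

(** A multiplicatively closed set containing 1 is a subgroup, [hT] being finite. *)
Lemma gen_closed (L : pred hT) :
    L 1 -> (forall x y, L x -> L y -> L (x * y)) -> (forall i, L (f i)) ->
  forall x, L x.
Proof.
move=> L1 LM Lf x; have gL : group_set [set x | L x].
  by apply/group_setP; split=> [|y z]; rewrite !inE //; apply: LM.
have: x \in <<[set f i | i : 'I_n]>> by rewrite genf inE.
suff /subsetP/[apply] : <<[set f i | i : 'I_n]>> \subset Group gL by rewrite inE.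
by rewrite gen_subG; apply/subsetP=> _ /imsetP[i _ ->]; rewrite inE.
Qed.

(** A relation between the rows holds on the generators, and by [closed] its solutions form a
    subgroup, so it holds on all of [hT]. The dual elements then kill each [c i], and [l] vanishes
    because some [sg (f i)] is nonzero. *)
Lemma gen_row_free (F : fieldType) k (sg : hT -> F) (al : 'I_k -> hT -> F) :
    (forall c l, let L x := (\sum_i c i * al i x = l * sg x)%R in
       L 1 /\ forall x y, L x -> L y -> L (x * y)) ->
    (forall i, exists2 x, sg x = 0%R & forall j, al j x = (j == i)%:R%R) ->
    (exists i, sg (f i) != 0%R) ->
  row_free (col_mx (\row_i sg (f i)) (\matrix_(j, i) al j (f i)))%R.
Proof.
move=> closed dual [i0 nz]; apply: inj_row_free => v.
rewrite -[v]hsubmxK mul_row_col; set l := lsubmx v; set c := rsubmx v => v0.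
pose L x := (\sum_i c 0 i * al i x == - l 0 0 * sg x)%R.
have [L1 LM] := closed (c 0)%R (- l 0 0)%R.
have Lx x : L x.
  apply: gen_closed => [|y z /eqP Ly /eqP Lz|i]; first exact/eqP.
    by apply/eqP/LM.
  have /rowP/(_ i) := v0; rewrite !mxE big_ord1 !mxE => /eqP.
  rewrite addrC addr_eq0 => /eqP eS; rewrite /L mulNr [l 0%R 0%R]mxE -eS; apply/eqP.
  by apply: eq_bigr => j _; rewrite !mxE.
have c0 : c = 0%R.
  apply/rowP=> i; have [x sx ax] := dual i; have := eqP (Lx x).
  rewrite sx mulr0 (bigD1 i) //= ax eqxx mulr1 big1 ?addr0 ?mxE // => j.
  by rewrite ax => /negPf->; rewrite mulr0.
have l0 : l = 0%R.
  have := eqP (Lx (f i0)); rewrite c0 big1 => [/esym/eqP|j _]; last by rewrite mxE mul0r.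
  rewrite mulf_eq0 (negPf nz) orbF oppr_eq0 => /eqP l0.
  by apply/rowP=> i; rewrite ord1 l0 mxE.
by rewrite l0 c0 row_mx0.
Qed.

End GenRowFree.

(** * Passage from the group ['Z_p] to the field ['F_p] *)

Section ZpToFp.
Variables (p : nat) (pr_p : prime p).

(** For prime [p] this is the identity on residues; the group law written [*] on ['Z_p] is
    addition. *)
Definition Zp_to_Fp (x : 'Z_p) : 'F_p := (nat_of_ord x)%:R%R.

Lemma Zp_to_FpM (x y : 'Z_p) : Zp_to_Fp (x * y) = (Zp_to_Fp x + Zp_to_Fp y)%R.
Proof.
rewrite /Zp_to_Fp -natrD -(Fp_nat_mod pr_p (x + y)); congr (_ *+ _)%R.
rewrite -[LHS]/((x + y) %% (Zp_trunc p).+2)%N; congr (_ %% _)%N.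
by rewrite Zp_cast ?prime_gt1.
Qed.

Lemma Zp_to_Fp1 : Zp_to_Fp 1 = 0%R.
Proof. by []. Qed.

Lemma Zp_to_FpV (x : 'Z_p) : Zp_to_Fp x^-1 = (- Zp_to_Fp x)%R.
Proof. by apply/eqP; rewrite -addr_eq0 -Zp_to_FpM mulVg. Qed.

Lemma Zp_to_Fp_inj : injective Zp_to_Fp.
Proof.
move=> x y /(congr1 (fun z : 'F_p => nat_of_ord z)).
have ltp (z : 'Z_p) : z < p.
  by apply: leq_trans (ltn_ord z) _; rewrite Zp_cast ?prime_gt1.
by rewrite /Zp_to_Fp !val_Fp_nat // !modn_small // => /val_inj.
Qed.

Lemma Zp_to_Fp_gen : Zp_to_Fp (1%R : 'Z_p) = 1%R.
Proof. by rewrite /Zp_to_Fp /= modn_small. Qed.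

End ZpToFp.

(** * Upper bound for the number of generating tuples of H *)

Section CountH.
Variables (pi : seq nat) (d n : nat).
Hypothesis pr_pi : all prime pi.
Hypothesis d_gt0 : 0 < d.
Implicit Types (i : Iodd pi) (h : HT pi d) (f : {ffun 'I_n -> HT pi d}).

Lemma Iodd_prime i : prime (ssval i).
Proof. by have := ssvalP i; rewrite mem_filter => /andP[_ /(allP pr_pi)]. Qed.

Lemma Iodd_neq2 i : ssval i != 2%N.
Proof. by have := ssvalP i; rewrite mem_filter => /andP[]. Qed.

(** The exponent of [y], and the coordinates in C_2^(d-1) and C_p^d read in the prime fields. *)
Let sg h : bool := h.1.2.
Let tc h (k : 'I_d.-1) : 'F_2 := Zp_to_Fp (h.2 k).
Let ac i h (k : 'I_d) : 'F_(ssval i) := Zp_to_Fp (h.1.1 i k).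

Lemma sgM g h : sg (g * h) = sg g (+) sg h.
Proof. by []. Qed.

Lemma tcM g h k : tc (g * h) k = (tc g k + tc h k)%R.
Proof. by rewrite /tc -Zp_to_FpM //= ffunE. Qed.

(** [y] inverts A, which makes the coordinates on A crossed homomorphisms. *)
Lemma acM i g h k : ac i (g * h) k = (ac i g k + (-1) ^+ sg g * ac i h k)%R.
Proof.
rewrite /ac /sg /=; case: g h => [[a s] t] [[b u] v] /=; rewrite ffunE ffunE.
rewrite Zp_to_FpM ?Iodd_prime //; congr (_ + _)%R.
case: s; rewrite /= ?mul1r // !ffunE Zp_to_FpV ?Iodd_prime // mulN1r //.
Qed.

Let smx (F : nzRingType) f : 'rV[F]_n := (\row_j (sg (f j))%:R)%R.
Let tmx f : 'M['F_2]_(d.-1, n) := (\matrix_(k, j) tc (f j) k)%R.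
Let amx f i : 'M['F_(ssval i)]_(d, n) := (\matrix_(k, j) ac i (f j) k)%R.

Section Generating.
Variable f : {ffun 'I_n -> HT pi d}.
Hypothesis genf : <<[set f j | j : 'I_n]>> = [set: HT pi d].

(** Otherwise all entries lie in the kernel of [sg], a proper subgroup. *)
Lemma gen_sg : exists j, sg (f j).
Proof.
case: (pickP (fun j => sg (f j))) => [j sj | nsg]; first by exists j.
have sgN x : ~~ sg x.
  apply: (gen_closed genf (L := fun x => ~~ sg x)) => //.
    by move=> y z; rewrite sgM; case: (sg y); case: (sg z).
  by move=> j; rewrite nsg.
by have := sgN ((1, true), 1).
Qed.

Lemma gen_tmx : row_free (col_mx (smx 'F_2 f) (tmx f)).
Proof.
apply: (gen_row_free genf (sg := fun h => (sg h)%:R%R) (al := fun k h => tc h k)).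
- move=> c l L; split=> [|x y]; rewrite /L.
    by rewrite mulr0 big1 // => k _; rewrite /tc ffunE Zp_to_Fp1 mulr0.
  move=> Lx Ly; rewrite sgM.
  have -> : ((sg x (+) sg y)%:R = (sg x)%:R + (sg y)%:R :> 'F_2)%R.
    by case: (sg x) (sg y) => [] []; apply/val_inj.
  rewrite mulrDr -Lx -Ly -big_split; apply: eq_bigr => k _ /=.
  by rewrite tcM mulrDr.
- move=> k; exists ((1, false), [ffun j => if j == k then (1%R : 'Z_2) else (1 : 'Z_2)])
    => // j.
  by rewrite /tc ffunE /=; case: eqP => _; rewrite ?Zp_to_Fp_gen.
have [j sj] := gen_sg; exists j; by rewrite sj.
Qed.

Lemma gen_amx i : row_free (col_mx (smx 'F_(ssval i) f) (amx f i)).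
Proof.
apply: (gen_row_free genf (sg := fun h => (sg h)%:R%R) (al := fun k h => ac i h k)).
- move=> c l L; split=> [|x y]; rewrite /L.
    by rewrite mulr0 big1 // => k _; rewrite /ac !ffunE Zp_to_Fp1 mulr0.
  move=> Lx Ly; rewrite sgM.
  (* [l * sg] is a crossed homomorphism for the same sign action as the coordinates, so the two
     sides agree on a subgroup. *)
  have -> : (l * (sg x (+) sg y)%:R = l * (sg x)%:R + (-1) ^+ sg x * (l * (sg y)%:R))%R.
    by case: (sg x) (sg y) => [] [] /=; ring.
  rewrite -Lx -Ly mulr_sumr -big_split; apply: eq_bigr => k _ /=.
  by rewrite acM; ring.
- move=> k; pose a : AT pi d := [ffun i' => [ffun j =>
    if (i' == i) && (j == k) then (1%R : 'Z_(ssval i')) else (1 : 'Z_(ssval i'))]].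
  exists ((a, false), 1) => // j.
  rewrite /ac /a /= !ffunE eqxx /=; case: eqP => _; rewrite ?Zp_to_Fp_gen ?Iodd_prime //.
have [j sj] := gen_sg; exists j; by rewrite sj oner_eq0.
Qed.
End Generating.

Let srow (F : nzRingType) (s : {ffun 'I_n -> bool}) : 'rV[F]_n := (\row_j (s j)%:R)%R.

Lemma srow_free (F : fieldType) (s : {ffun 'I_n -> bool}) j : s j -> row_free (srow F s).
Proof.
move=> sj; rewrite /row_free rank_rV eqb1; apply/eqP=> /rowP/(_ j)/eqP.
by rewrite !mxE sj oner_eq0.
Qed.

(** The vector [s] of [y]-exponents is nonzero. Once it is fixed, the blocks for different primes
    are counted independently, each extending the row [s] to a matrix of full row rank; that row
    accounts for the exponent [k.+1] at odd primes. *)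
Lemma gen_count_Hpid_le :
  gen_count (Hpid pi d) n <=
    \prod_(k < d) (2 ^ n - 2 ^ k) *
    \prod_(i : Iodd pi) \prod_(k < d) (ssval i ^ n - ssval i ^ k.+1).
Proof.
pose MA := {dffun forall i : Iodd pi, 'M['F_(ssval i)]_(d, n)}.
pose Phi f : {ffun 'I_n -> bool} * ('M['F_2]_(d.-1, n) * MA) :=
  ([ffun j => sg (f j)], (tmx f, [ffun i => amx f i])).
have Phi_inj : injective Phi.
  move=> f g [/ffunP eqs /matrixP eqt /ffunP eqa]; apply/ffunP=> j.
  have := eqs j; have := eqt ^~ j; have eqaj i k : ac i (f j) k = ac i (g j) k.
    by have := eqa i; rewrite !ffunE => /matrixP/(_ k j); rewrite !mxE.
  rewrite !ffunE /sg => eqtj; have {}eqtj k : tc (f j) k = tc (g j) k.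
    by have := eqtj k; rewrite !mxE.
  case: (f j) (g j) eqaj eqtj => [[a s] t] [[b u] v] eqaj eqtj /= ->.
  congr ((_, _), _); apply/ffunP=> i.
    by apply/ffunP=> k; apply: (Zp_to_Fp_inj (Iodd_prime i)); apply: eqaj.
  by apply: (@Zp_to_Fp_inj 2) => //; apply: eqtj.
pose P (s : {ffun 'I_n -> bool}) := [exists j, s j].
pose QT s : pred 'M['F_2]_(d.-1, n) := fun T => row_free (col_mx (srow 'F_2 s) T).
pose QA s i : pred 'M['F_(ssval i)]_(d, n) :=
  fun B => row_free (col_mx (srow 'F_(ssval i) s) B).
pose Q s (y : 'M['F_2]_(d.-1, n) * MA) := (y.1 \in QT s) && (y.2 \in family (QA s)).
rewrite /gen_count -(card_imset _ Phi_inj).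
apply: (@leq_trans #|[set x : _ * _ | P x.1 && Q x.1 x.2]|).
  apply: subset_leq_card; apply/subsetP=> x /imsetP[f genf ->].
  move: genf; rewrite in_set => /andP[_ /eqP genf]; rewrite in_set.
  have srowE (F : nzRingType) : srow F (Phi f).1 = smx F f.
    by apply/rowP=> j; rewrite !mxE ffunE.
  apply/and3P; split.
  - by have [j sj] := gen_sg genf; apply/existsP; exists j; rewrite ffunE.
  - by rewrite [_ \in _]/(row_free _) srowE; apply: gen_tmx.
  - by apply/familyP=> i; rewrite [_ \in _]/(row_free _) srowE /= ffunE; apply: gen_amx.
rewrite card_dep_pair.
set b := (\prod_(i : Iodd pi) _)%N.
apply: (@leq_trans (\sum_(s | P s) (\prod_(k < d.-1) (2 ^ n - 2 ^ (1 + k)) * b))%N).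
  apply: leq_sum => s /existsP[j sj].
  have -> : #|Q s| = (#|QT s| * #|(family (QA s) : simpl_pred MA)|)%N.
    by rewrite -cardX; apply: eq_card.
  apply: leq_mul.
    have := card_row_free_ext d.-1 (srow_free 'F_2 sj).
    by rewrite cardsE card_Fp.
  rewrite card_family foldrE big_map big_enum /=; apply: leq_prod => i _.
  have := card_row_free_ext d (srow_free 'F_(ssval i) sj).
  by rewrite cardsE card_Fp ?Iodd_prime.
(* The factor at [k = 0] counts the nonzero vectors [s]. *)
have -> : (\prod_(k < d) (2 ^ n - 2 ^ k) =
           (2 ^ n - 1) * \prod_(k < d.-1) (2 ^ n - 2 ^ (1 + k)))%N.
  by case: (d) d_gt0 => // d' _; rewrite big_ord_recl.
rewrite sum_nat_const -mulnA leq_mul2r; apply/orP; right.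
have -> : (2 ^ n - 1 = #|[set~ [ffun=> false] : {ffun 'I_n -> bool}]|)%N.
  by rewrite cardsC1 card_ffun card_bool card_ord subn1.
apply: subset_leq_card; apply/subsetP=> s /existsP[j sj]; rewrite !inE.
by apply: contraTneq sj => ->; rewrite ffunE.
Qed.

Lemma card_Hpid : #|Hpid pi d| = (2 ^ d * \prod_(i : Iodd pi) ssval i ^ d)%N.
Proof.
rewrite cardsT card_prod card_prod card_bool -mulnA mulnC.
congr (_ * _)%N.
  rewrite card_ffun !card_ord -expnS prednK //.
rewrite card_dep_ffun foldrE big_map big_enum /=; apply: eq_bigr => i _.
by rewrite card_ffun !card_ord Zp_cast ?prime_gt1 ?Iodd_prime.
Qed.

End CountH.

(** * Comparison of P_H(n) with P_G(n) *)

Lemma big_seq_sub (o : seq nat) (F : nat -> rat) : uniq o ->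
  (\prod_(i : seq_sub o) F (ssval i) = \prod_(p <- o) F p)%R.
Proof.
move=> uniq_o; rewrite -(big_map (@ssval _ o) predT F); apply: perm_big.
apply: uniq_perm => // [|p].
  by rewrite map_inj_uniq ?index_enum_uniq //; apply: val_inj.
apply/mapP/idP=> [[i _ ->] | op]; first exact: ssvalP.
by exists (SeqSub op); rewrite ?mem_index_enum.
Qed.

(** As [r <= n], the subtractions in [nat] are not truncated. *)
Lemma prime_factorE n p r : prime p -> r <= n ->
  prime_factor n p r =
    ((\prod_(k < r) (p ^ n - p ^ ((p != 2) + k)))%:R / ((p ^ r) ^ n)%:R)%R.
Proof.
move=> pr_p le_rn; have -> : ((p ^ r) ^ n = \prod_(k < r) p ^ n)%N.
  by rewrite prod_nat_const card_ord expnAC.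
rewrite !natr_prod -prodf_div; apply: eq_bigr => k _.
have p_gt0 : 0 < p ^ n by rewrite expn_gt0 prime_gt0.
rewrite natrB ?mulrBl ?divff ?pnatr_eq0 -?lt0n // leq_exp2l ?prime_gt1 //.
apply: leq_trans (leq_trans (ltn_ord k) le_rn).
by rewrite -[k.+1]add1n leq_add2r leq_b1.
Qed.

Section Compare.
Variables (pi : seq nat) (d : nat).
Hypotheses (pr_pi : all prime pi) (d_gt0 : 0 < d).
Let o := [seq p <- pi | p != 2%N].

(** A factor of the upper bound vanishes: [2 ^ n - 2 ^ k] at [k = n] when [n < d], and
    [p ^ n - p ^ k.+1] at [k = d.-1] for an odd [p] when [n = d]. *)
Lemma gen_count_Hpid_eq0 n :
  n < d \/ n = d /\ o != [::] -> gen_count (Hpid pi d) n = 0%N.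
Proof.
move=> H; apply/eqP; rewrite -leqn0; apply: leq_trans (gen_count_Hpid_le n pr_pi d_gt0) _.
rewrite leqn0 muln_eq0; case: H => [lt_nd | [-> ]].
  by rewrite (bigD1 (Ordinal lt_nd)) //= subnn mul0n.
case defo : o => [|p o'] // _; have op : p \in o by rewrite defo mem_head.
have ltd : d.-1 < d by rewrite prednK.
apply/orP; right; rewrite (bigD1 (SeqSub op)) // (bigD1 (Ordinal ltd)) //= prednK //.
by rewrite subnn !mul0n.
Qed.

Lemma gen_prob_Hpid_le n : uniq o -> d <= n ->
  (gen_prob (Hpid pi d) n <= \prod_(p <- 2%N :: o) prime_factor n p d)%R.
Proof.
move=> uniq_o le_dn; rewrite /gen_prob card_Hpid //.
have -> : (\prod_(p <- 2%N :: o) prime_factor n p d =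
    (\prod_(k < d) (2 ^ n - 2 ^ k) *
    \prod_(i : Iodd pi) \prod_(k < d) (ssval i ^ n - ssval i ^ k.+1))%N%:R /
    ((2 ^ d * \prod_(i : Iodd pi) ssval i ^ d) ^ n)%N%:R)%R.
  rewrite big_cons -big_seq_sub // prime_factorE // expnMn !natrM invfM mulrACA.
  congr (_ * _)%R.
  have -> : ((\prod_(i : Iodd pi) ssval i ^ d) ^ n = \prod_(i : Iodd pi) (ssval i ^ d) ^ n)%N.
    by rewrite (big_morph (fun x => x ^ n)%N (fun x y => expnMn x y n) (exp1n n)).
  rewrite !natr_prod -prodf_div; apply: eq_bigr => i _.
  by rewrite prime_factorE ?(Iodd_prime pr_pi i) // Iodd_neq2.
apply: ler_wpM2r; first by rewrite invr_ge0 ler0n.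
by rewrite ler_nat gen_count_Hpid_le.
Qed.
End Compare.

Lemma gen_prob_le_Hpid (gT : finGroupType) (G : {group gT}) d n :
    solvable G -> 0 < d ->
    (forall p P, prime p -> P \in 'Syl_p(G) -> 'm(P) <= d) ->
  (gen_prob (Hpid (2%N :: primes #|G|) d) n <= gen_prob G n)%R.
Proof.
move=> solG d_gt0 rkG; set pi := 2%N :: primes #|G|.
have pr_pi : all prime pi by rewrite /= all_prime_primes.
(* [pi] repeats 2 when [G] has even order; [2 :: o] lists the same primes once each. *)
pose o := [seq p <- pi | p != 2%N].
have uniq_o : uniq o by rewrite /o /= filter_uniq ?primes_uniq.
have pr_o : all prime (2%N :: o).
  by apply/allP=> p; rewrite inE mem_filter => /predU1P[-> // | /andP[_ /(allP pr_pi)]].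
have no2 : 2%N \notin o by rewrite mem_filter eqxx.
(* In the first case [n] elements cannot generate H and the left side is 0. Otherwise [d <= n], and
   [n = d] leaves only 2-groups, as the product bound requires. *)
have [small|] := boolP ((n < d) || (n == d) && (o != [::])).
  rewrite /gen_prob gen_count_Hpid_eq0 ?mul0r ?divr_ge0 ?ler0n //.
  by case/orP: small => [|/andP[/eqP]]; auto.
rewrite negb_or -leqNgt negb_and negbK => /andP[le_dn big_n].
apply: le_trans (gen_prob_Hpid_le pr_pi d_gt0 uniq_o le_dn) _.
apply: prod_prime_factor_le_gen_prob => //=.
- by rewrite no2.
- by move=> p pG; rewrite inE mem_filter pG andbT orbN.
- move=> p op; have [P sylP] := Sylow_exists p G; exists P => //.
  by apply: (rkG p); rewrite ?inE //; apply: (allP pr_o).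
case/orP: big_n => [neq_nd | /eqP o0]; [right | left].
  by rewrite ltn_neqAle eq_sym neq_nd.
apply/pgroupP=> q pr_q q_dv; rewrite inE; apply/negPn/negP=> q2.
have : q \in o by rewrite mem_filter q2 /pi inE mem_primes pr_q cardG_gt0 q_dv orbT.
by rewrite o0.
Qed.

(** * Convergence of the series and comparison of the sums *)

(** A tuple in [G] that fails to generate [G] generates a proper subgroup [K], of order at most
    [|G| / 2]; the sum of the bounds [|K| ^ n] is estimated over all subgroups of [gT]. *)
Lemma nongen_count_le (gT : finGroupType) (G : {group gT}) n :
  2 ^ n * (#|G| ^ n - gen_count G n) <= #|{group gT}| * #|G| ^ n.
Proof.
pose A := [set f : {ffun 'I_n -> gT} | f \in ffun_on G].
pose B := [set f : {ffun 'I_n -> gT} |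
  (f \in ffun_on G) && (<<[set f i | i : 'I_n]>> == G)].
have cardA : #|A| = (#|G| ^ n)%N by rewrite cardsE card_ffun_on card_ord.
have -> : (#|G| ^ n - gen_count G n = #|A :\: B|)%N.
  rewrite cardsD cardA; congr (_ - _)%N; apply: eq_card => f.
  by rewrite in_setI !in_set; case: (f \in _).
pose span (f : {ffun 'I_n -> gT}) := <<[set f i | i : 'I_n]>>%G.
rewrite -sum1_card (partition_big span predT) //=.
rewrite big_distrr -sum1_card big_distrl /=.
rewrite [X in _ <= X](eq_bigl predT) //; apply: leq_sum => K _; rewrite mul1n.
rewrite sum1dep_card.
have [->|[f0]] := set_0Vmem [set f | (f \in A :\: B) & <<[set f i | i : 'I_n]>>%G == K].
  by rewrite cards0 muln0.
rewrite in_set => /andP[]; rewrite in_setD !in_set => /andP[bad Gf0] /eqP defK.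
have sKG : K \proper G.
  rewrite properEneq -defK /= gen_subG; apply/andP; split.
    by move: bad; rewrite Gf0.
  by apply/subsetP=> _ /imsetP[i _ ->]; apply: (ffun_onP Gf0).
apply: (@leq_trans (2 ^ n * #|K| ^ n)%N).
  have <- : #|[set f : {ffun 'I_n -> gT} | f \in ffun_on K]| = (#|K| ^ n)%N.
    by rewrite cardsE card_ffun_on card_ord.
  rewrite leq_mul2l; apply/orP; right; apply: subset_leq_card; apply/subsetP=> f.
  rewrite !in_set => /andP[_ /eqP <-].
  by apply/ffun_onP=> i; rewrite mem_gen ?imset_f.
rewrite -expnMn -(Lagrange (proper_sub sKG)) mulnC.
have [n0|n_gt0] := posnP n; first by rewrite n0.
rewrite leq_exp2r // leq_mul2l indexg_gt1 proper_subn ?orbT //.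
Qed.

Section RealSeries.
Local Open Scope R_scope.

Lemma infinite_sum_le (a b : nat -> R) la lb : (forall n, a n <= b n) ->
  infinite_sum a la -> infinite_sum b lb -> la <= lb.
Proof.
move=> le_ab cva cvb.
refine (@Rle_cv_lim (sum_f_R0 a) (sum_f_R0 b) la lb _ cva cvb) => N.
exact: sum_Rle.
Qed.

Lemma infinite_sum_comparison (a b : nat -> R) : (forall n, 0 <= a n <= b n) ->
  (exists l, infinite_sum b l) -> exists l, infinite_sum a l.
Proof.
move=> le_ab [l cvb].
have [la cva] := Rseries_CV_comp a b le_ab (exist _ l cvb).
by exists la.
Qed.

Lemma infinite_sum_half (K : R) : exists l, infinite_sum (fun n => K * / 2 ^ n) l.
Proof.
have lt1 : Rabs (/ 2) < 1 by rewrite Rabs_pos_eq; Lra.lra.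
have cv := GP_infinite _ lt1.
exists (K * / (1 - / 2)) => eps eps_gt0.
(* Adding 1 keeps the divisor positive when [K = 0]. *)
have K1 : 0 < Rabs K + 1 by have := Rabs_pos K; Lra.lra.
have [N HN] := cv (eps / (Rabs K + 1)) (Rdiv_lt_0_compat _ _ eps_gt0 K1).
exists N => n /HN; rewrite /Rdist => lt_n.
have -> : sum_f_R0 (fun n => K * / 2 ^ n) n = K * sum_f_R0 (fun n => 1 * (/ 2) ^ n) n.
  rewrite scal_sum; apply: PartSum.sum_eq => i _.
  by rewrite pow_inv Rmult_1_l Rmult_comm.
rewrite -Rmult_minus_distr_l Rabs_mult.
move: lt_n; set x := Rabs _ => lt_n.
have x_ge0 : 0 <= x by apply: Rabs_pos.
apply: (Rle_lt_trans _ ((Rabs K + 1) * x)).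
  by apply: Rmult_le_compat_r => //; Lra.lra.
have -> : eps = (Rabs K + 1) * (eps / (Rabs K + 1)).
  by rewrite /Rdiv Rmult_comm Rmult_assoc Rinv_l; Lra.lra.
exact: Rmult_lt_compat_l.
Qed.
End RealSeries.

(** Clearing denominators reduces both inequalities to the same one in [nat], which carries the
    bound from [rat] to the reals. *)
Lemma probgen_le (gT hT : finGroupType) (G : {group gT}) (H : {group hT}) n :
  (gen_prob H n <= gen_prob G n)%R -> Rle (probgen H n) (probgen G n).
Proof.
have INR_gt0 m : 0 < m -> Rlt 0 (INR m) by move=> m_gt0; apply/lt_0_INR/ssrnat.ltP.
have expG : 0 < #|G| ^ n by rewrite expn_gt0 cardG_gt0.
have expH : 0 < #|H| ^ n by rewrite expn_gt0 cardG_gt0.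
rewrite /gen_prob ler_pdivrMr ?ltr0n // mulrAC ler_pdivlMr ?ltr0n // -!natrM ler_nat.
move=> /ssrnat.leP/le_INR; rewrite -!multE !mult_INR => le_HG.
rewrite /probgen; apply: (Rmult_le_reg_r (INR (#|H| ^ n))); first exact: INR_gt0.
apply: (Rmult_le_reg_r (INR (#|G| ^ n))); first exact: INR_gt0.
have := INR_gt0 _ expG; have := INR_gt0 _ expH; move: le_HG; rewrite /Rdiv.
move: (INR (#|H| ^ n)) (INR (#|G| ^ n)) => x y le_HG x_gt0 y_gt0.
have -> : Rmult (Rmult (Rmult (INR (gen_count H n)) (Rinv x)) x) y =
    Rmult (INR (gen_count H n)) y.
  by rewrite (Rmult_assoc _ (Rinv x)) Rinv_l ?Rmult_1_r //; apply: Rgt_not_eq.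
suff -> : Rmult (Rmult (Rmult (INR (gen_count G n)) (Rinv y)) x) y =
    Rmult (INR (gen_count G n)) x by [].
rewrite Rmult_assoc (Rmult_comm x) -Rmult_assoc (Rmult_assoc _ (Rinv y)) Rinv_l ?Rmult_1_r //.
exact: Rgt_not_eq.
Qed.

(** Domination by a geometric series makes the series for e(G) converge. *)
Lemma probgen_compl_itv (gT : finGroupType) (G : {group gT}) n :
  Rle 0 (Rminus 1 (probgen G n)) /\
  Rle (Rminus 1 (probgen G n)) (Rmult (INR #|{group gT}|) (Rinv (pow 2 n))).
Proof.
have := nongen_count_le G n.
have : gen_count G n <= #|G| ^ n.
  apply: (@leq_trans #|[set f : {ffun 'I_n -> gT} | f \in ffun_on G]|).
    by apply: subset_leq_card; apply/subsetP=> f; rewrite !in_set => /andP[].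
  by rewrite cardsE card_ffun_on card_ord.
have : 0 < #|G| ^ n by rewrite expn_gt0 cardG_gt0.
rewrite /probgen; move: (#|G| ^ n)%N (gen_count G n) #|{group gT}| => y a k.
move=> /ssrnat.ltP/lt_0_INR y_gt0 le_ay.
have INRexp m : INR (2 ^ m) = pow 2 m.
  by elim: m => // m IH; rewrite expnS -multE mult_INR IH.
move/ssrnat.leP/le_INR; rewrite -!multE !mult_INR INRexp -minusE minus_INR;
  last exact/ssrnat.leP.
move: le_ay => /ssrnat.leP/le_INR.
have : Rlt 0 (pow 2 n) by apply: pow_lt; Lra.lra.
move: (INR y) (INR a) (INR k) (pow 2 n) y_gt0 => {y}y {a}a {k}k z y_gt0 z_gt0 le_ay le_k.
have eqa : Rmult (Rdiv a y) y = a.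
  by rewrite /Rdiv Rmult_assoc Rinv_l ?Rmult_1_r //; apply: Rgt_not_eq.
have eqz : Rmult (Rinv z) z = INR 1 by apply: Rinv_l; apply: Rgt_not_eq.
move: (Rdiv a y) (Rinv z) eqa eqz => q w eqa eqz; rewrite -eqa in le_ay le_k.
split.
  suff: Rle q 1 by Lra.lra.
  by apply: (Rmult_le_reg_r y); Lra.lra.
apply: (Rmult_le_reg_r z) => //; apply: (Rmult_le_reg_r y) => //.
have -> : Rmult (Rmult (Rmult k w) z) y = Rmult (Rmult k y) (Rmult w z) by Lra.lra.
by rewrite eqz /=; Lra.lra.
Qed.

Theorem theorem5 (gT : finGroupType) (G : {group gT}) (d : nat) :
  solvable G ->
  (0 < d)%N ->
  (forall (p : nat) (P : {group gT}), prime p -> P \in ('Syl_p(G))%g ->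
     exists X : {set gT}, (#|X| <= d)%N /\ <<X>>%g = P) ->
  exists eG eH : R,
    e_is G eG /\ e_is (Hpid (2%N :: primes #|G|) d) eH /\ Rle eG eH.
Proof.
move=> solG d_gt0 genSyl.
have rkSyl (p : nat) (P : {group gT}) : prime p -> P \in 'Syl_p(G) -> 'm(P) <= d.
  move=> pr_p /(genSyl p P pr_p)[X [leXd <-]].
  exact: leq_trans (grank_min X) leXd.
set H := Hpid _ _.
have cv (hT : finGroupType) (K : {group hT}) : exists l, e_is K l.
  apply: infinite_sum_comparison (infinite_sum_half (INR #|{group hT}|)) => n.
  exact: probgen_compl_itv.
have [[eG cvG] [eH cvH]] := (cv _ G, cv _ H).
exists eG, eH; split=> //; split=> //; apply: infinite_sum_le cvG cvH => n.
apply: Rplus_le_compat_l; apply: Ropp_le_contravar; apply: probgen_le.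
exact: gen_prob_le_Hpid.
Qed.
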